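(* Let $a,b,c$ be real numbers with $a\ge c>0$ and $b\ge c>0$. If $f(z)=z+\sum_{k=2}^{\infty}a_kz^k$ belongs to the class $\mathcal{R}_{a,b}^{c}$, then for any $\mu\in\mathbb{C}$, $$|a_3-\mu a_2^2|\le \frac{(c)_2}{(a)_2(b)_2}\max\left\{1,\ \frac{|ab(c+1)+\mu c(a+1)(b+1)|}{4ab(c+1)}\right\}.$$ The estimate is sharp.
   Context: $\mathcal{U}=\{z\in\mathbb{C}:|z|<1\}$. $\mathcal{A}$ is the class of functions analytic in $\mathcal{U}$ of the form $f(z)=z+\sum_{k\ge2}a_kz^k$. $(\alpha)_0=1$ and $(\alpha)_n=\alpha(\alpha+1)\cdots(\alpha+n-1)$ for $n\ge1$. The Hohlov operator $\mathcal{I}_{a,b}^{c}:\mathcal{A}\to\mathcal{A}$ is the Hadamard product (coefficientwise product of power series) of $f$ with $z\,{}_2F_1(a,b;c;z)$, i.e. $\mathcal{I}_{a,b}^{c}f(z)=z+\sum_{n\ge1}\frac{(a)_n(b)_n}{(c)_n\,n!}a_{n+1}z^{n+1}$. For $g,h$ analytic in $\mathcal{U}$, $g\prec h$ ($g$ is subordinate to $h$) means $g(z)=h(\omega(z))$ for some analytic $\omega$ on $\mathcal{U}$ with $\omega(0)=0$, $|\omega(z)|<1$. The class $\mathcal{R}_{a,b}^{c}$ consists of all $f\in\mathcal{A}$ with $\frac{\mathcal{I}_{a,b}^{c}f(z)}{z}\prec\sqrt{1+z}$ in $\mathcal{U}$ (principal branch, value $1$ at $z=0$). ''Sharp'' means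 that for each admissible choice of the parameters ($a,b,c,\mu$), equality is attained by some function in $\mathcal{R}_{a,b}^{c}$. *)

(* Defs.v *)
From Stdlib Require Import Reals Lra Factorial.
From Coquelicot Require Import Coquelicot.
Open Scope R_scope.

Definition in_disk (z : C) : Prop := Cmod z < 1.

(* A function on the unit disk is a total function [C -> C] of which only the
   values on the disk matter. *)
Definition analytic_in_disk (f : C -> C) : Prop :=
  forall z : C, in_disk z -> @ex_derive C_AbsRing C_NormedModule f z.

Definition disk_series (t : nat -> C) (f : C -> C) : Prop :=
  forall z : C, in_disk z -> @is_pseries C_AbsRing C_NormedModule t z (f z).

Definition classA (f : C -> C) : Prop :=
  analytic_in_disk f /\
  exists t : nat -> C, t 0%nat = RtoC 0 /\ t 1%nat = RtoC 1 /\ disk_series t f.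

Fixpoint poch (x : R) (n : nat) : R :=
  match n with
  | O => 1
  | S m => poch x m * (x + INR m)
  end.

Definition hyp2F1_coef (a b c : R) (n : nat) : C :=
  RtoC (poch a n * poch b n / (poch c n * INR (fact n))).

Definition hadamard_coef (s t : nat -> C) (n : nat) : C := Cmult (s n) (t n).

(* [hohlov a b c f g]: [g] is the image of [f] under the Hohlov operator.
   [PS_incr_1] shifts the coefficients of 2F1 to those of z 2F1(a,b;c;z). *)
Definition hohlov (a b c : R) (f g : C -> C) : Prop :=
  exists t : nat -> C,
    disk_series t f /\
    disk_series
      (hadamard_coef (@PS_incr_1 C_AbsRing C_NormedModule (hyp2F1_coef a b c)) t) g.

(* [p] is g(z)/z with its removable singularity at 0 filled in; the bare
   quotient would have the junk value 0 there. *)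
Definition quotient_by_z (g p : C -> C) : Prop :=
  analytic_in_disk p /\
  forall z : C, in_disk z -> z <> RtoC 0 -> p z = Cdiv (g z) z.

Definition subordinate (g h : C -> C) : Prop :=
  exists w : C -> C,
    analytic_in_disk w /\ w (RtoC 0) = RtoC 0 /\
    forall z : C, in_disk z -> in_disk (w z) /\ g z = h (w z).

(* Principal square root, with cut along the negative reals: the root with
   nonnegative real part (and with nonnegative imaginary part on the cut). *)
Definition Csqrt (z : C) : C :=
  let u := sqrt ((Cmod z + Re z) / 2) in
  let v := sqrt ((Cmod z - Re z) / 2) in
  (u, if Rlt_dec (Im z) 0 then - v else v).

Lemma Csqrt_sqr (z : C) : Cmult (Csqrt z) (Csqrt z) = z.
Proof.
destruct z as [x y]; unfold Csqrt, Re, Im, Cmult; simpl fst; simpl snd.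
assert (Hx : Rabs x <= Cmod (x, y))
  by (apply Rle_trans with (2 := Rmax_Cmod (x, y)); apply Rmax_l).
assert (Hm : Cmod (x, y) * Cmod (x, y) = x * x + y * y).
{ unfold Cmod; simpl; rewrite sqrt_sqrt; [ring | nra]. }
set (m := Cmod (x, y)) in *.
assert (Hp : 0 <= (m + x) / 2)
  by (generalize (Rabs_maj2 x); lra).
assert (Hq : 0 <= (m - x) / 2)
  by (generalize (Rle_abs x); lra).
assert (Huv : sqrt ((m + x) / 2) * sqrt ((m - x) / 2) = Rabs y / 2).
{ rewrite <- sqrt_mult by assumption.
  replace ((m + x) / 2 * ((m - x) / 2)) with (Rsqr (y / 2))
    by (unfold Rsqr; nra).
  rewrite sqrt_Rsqr_abs; unfold Rdiv; rewrite Rabs_mult.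
  rewrite (Rabs_pos_eq (/ 2)); lra. }
generalize (sqrt_sqrt _ Hp) (sqrt_sqrt _ Hq); intros Hu Hv.
destruct (Rlt_dec y 0) as [Hy | Hy];
  [rewrite Rabs_left in Huv by lra | rewrite Rabs_pos_eq in Huv by lra];
  f_equal; lra.
Qed.

Lemma Csqrt_Re_ge0 (z : C) : 0 <= Re (Csqrt z).
Proof. apply sqrt_pos. Qed.

Definition sqrt_1p (z : C) : C := Csqrt (Cplus (RtoC 1) z).

Definition classR (a b c : R) (f : C -> C) : Prop :=
  classA f /\
  exists g p : C -> C,
    hohlov a b c f g /\ quotient_by_z g p /\ subordinate p sqrt_1p.

(* Main.v *)
(* Write I f(z)/z = p(z) = sqrt(1 + w(z)), so that w = p^2 - 1 and, with
   p = 1 + q_1 z + q_2 z^2 + ..., w_1 = 2 q_1 and w_2 = 2 q_2 + q_1^2. Then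
   a_3 - mu a_2^2 = (c)_2/((a)_2 (b)_2) (w_2 - nu w_1^2), and the bound is
   |w_2 - nu w_1^2| <= max(1, |nu|), with equality for w = z or w = z^2.

   This follows from |w_2| <= 1 - |w_1|^2. Since |w| < 1, multiplication by w/z does
   not increase the mean square over circles; applied to 1 + b z and with Bessel's
   inequality this gives |w_1|^2 + |w_2 + b w_1|^2 <= 1 + |b|^2 for all b. As p is the
   sum of a power series, it suffices to take means of polynomials, and these over
   roots of unity.

   For sharpness, the binomial series S of exponent 1/2 satisfies S^2 = 1 + z by a
   Cauchy product, and |S - 1| <= |z| because the moduli of its coefficients of
   positive index add up to at most 1; hence S is the principal square root. *)

Require Import Defs.
From Stdlib Require Import Reals Lra Lia Factorial ClassicalEpsilon.
From Coquelicot Require Import Coquelicot.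
Open Scope R_scope.

(** * Means of polynomials over a circle *)

(* Coquelicot's algebraic lemmas leave equations typed in a structure over [C]. *)
Ltac cring := match goal with |- @eq _ ?x ?y => change (@eq C x y) end; ring.

(** Horner form, as a property of functions: the pointwise equations avoid functional
    extensionality, and induction peels off one factor z at a time. *)
Inductive polynomial (F : C -> C) : Prop :=
| polynomial_const (c : C) : (forall z, F z = c) -> polynomial F
| polynomial_step (c : C) (G : C -> C) :
    polynomial G -> (forall z, F z = (c + z * G z)%C) -> polynomial F.

Lemma polynomial_ext (F G : C -> C) :
  (forall z, F z = G z) -> polynomial F -> polynomial G.
Proof.
intros E [c Hc | c H HH Hc].
- apply (polynomial_const G c); intros z; now rewrite <- E.
- apply (polynomial_step G c H HH); intros z; now rewrite <- E.
Qed.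

Lemma polynomial_scal (k : C) (F : C -> C) :
  polynomial F -> polynomial (fun z => k * F z)%C.
Proof.
induction 1 as [F c Hc | F c G HG IH Hc].
- apply (polynomial_const _ (k * c)%C); intros z; now rewrite Hc.
- apply (polynomial_step _ (k * c)%C _ IH); intros z; rewrite Hc; ring.
Qed.

Lemma polynomial_plus (F G : C -> C) :
  polynomial F -> polynomial G -> polynomial (fun z => F z + G z)%C.
Proof.
intros HF; revert G; induction HF as [F c Hc | F c F' HF' IH Hc];
  intros G [d Hd | d G' HG' Hd].
- apply (polynomial_const _ (c + d)%C); intros z; now rewrite Hc, Hd.
- apply (polynomial_step _ (c + d)%C _ HG'); intros z; rewrite Hc, Hd; ring.
- apply (polynomial_step _ (c + d)%C _ HF'); intros z; rewrite Hc, Hd; ring.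
- apply (polynomial_step _ (c + d)%C _ (IH _ HG')); intros z; rewrite Hc, Hd; ring.
Qed.

Lemma polynomial_mult (F G : C -> C) :
  polynomial F -> polynomial G -> polynomial (fun z => F z * G z)%C.
Proof.
intros HF HG; induction HF as [F c Hc | F c F' HF' IH Hc].
- apply (polynomial_ext (fun z => c * G z)%C); [now intros z; rewrite Hc |].
  now apply polynomial_scal.
- apply (polynomial_ext (fun z => c * G z + (0 + z * (F' z * G z)))%C);
    [intros z; rewrite Hc; ring |].
  apply polynomial_plus; [now apply polynomial_scal |].
  now apply (polynomial_step _ 0 _ IH).
Qed.

Lemma polynomial_id : polynomial (fun z => z).
Proof.
apply (polynomial_step _ 0 (fun _ => RtoC 1)).
- now apply (polynomial_const _ 1).
- intros z; ring.
Qed.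

Lemma polynomial_cst (c : C) : polynomial (fun _ => c).
Proof. now apply (polynomial_const _ c). Qed.

Lemma de_moivre (t : R) (n : nat) :
  Cpow (cos t, sin t) n = (cos (INR n * t), sin (INR n * t)).
Proof.
induction n as [|n IH].
- simpl; rewrite Rmult_0_l, cos_0, sin_0; reflexivity.
- rewrite Cpow_S, IH, S_INR, Rmult_plus_distr_r, Rmult_1_l, cos_plus, sin_plus.
  unfold Cmult; simpl; f_equal; ring.
Qed.

Lemma primitive_root (N : nat) :
  exists w : C, Cmod w = 1 /\ Cpow w (S N) = 1 /\
    forall s : nat, (0 < s < S N)%nat -> Cpow w s <> 1.
Proof.
set (t := 2 * PI / INR (S N)).
assert (HN : 0 < INR (S N)) by (apply lt_0_INR; lia).
exists (cos t, sin t); split; [|split].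
- apply eq_trans with (2 := sqrt_1); unfold Cmod; simpl; f_equal.
  generalize (sin2_cos2 t); unfold Rsqr; lra.
- rewrite de_moivre; replace (INR (S N) * t) with (2 * PI) by (unfold t; field; lra).
  now rewrite cos_2PI, sin_2PI.
- intros s Hs; rewrite de_moivre; intros E; injection E; intros _ Ec.
  assert (Hs0 : 0 < INR s) by (apply lt_0_INR; lia).
  assert (HsN : INR s < INR (S N)) by (apply lt_INR; lia).
  (* The half angle is pi s / (N + 1), strictly between 0 and pi, so cos x = 1 - 2 sin^2 (x/2) rules
     out cos x = 1. *)
  assert (Hp : 0 < sin (INR s * t / 2)).
  { generalize PI_RGT_0; intros HPI.
    replace (INR s * t / 2) with (PI * (INR s / INR (S N))) by (unfold t; field; lra).
    assert (0 < INR s / INR (S N)) by (apply Rdiv_lt_0_compat; lra).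
    assert (INR s / INR (S N) < 1)
      by (apply Rmult_lt_reg_r with (INR (S N));
          [lra | unfold Rdiv; rewrite Rmult_assoc, Rinv_l; lra]).
    apply sin_gt_0; nra. }
  generalize (cos_2a_sin (INR s * t / 2)).
  replace (2 * (INR s * t / 2)) with (INR s * t) by field.
  rewrite Ec; nra.
Qed.

Lemma geometric_sum (x : C) (n : nat) :
  ((x - 1) * sum_n (fun j => Cpow x j) n = Cpow x (S n) - 1)%C.
Proof.
induction n as [|n IH].
- rewrite sum_O; simpl; ring.
- rewrite sum_Sn; change plus with Cplus.
  rewrite Cmult_plus_distr_l, IH, !Cpow_S; ring.
Qed.

(** As [d] bounds the degree of [F], the exponents in z^s F run from s to s + d, strictly between 0
    and N + 1. Each contributes a geometric sum whose ratio is a power of w other than 1. The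
    exponent s is left free because the Horner step moves a factor z into the power. *)
Lemma mean_zero (r : R) (F : C -> C) :
  polynomial F -> exists d : nat, forall (N s : nat) (w : C),
    (0 < s)%nat -> (s + d < S N)%nat -> Cpow w (S N) = 1 ->
    (forall s : nat, (0 < s < S N)%nat -> Cpow w s <> 1) ->
    sum_n (fun j => Cpow (r * Cpow w j) s * F (r * Cpow w j))%C N = RtoC 0.
Proof.
assert (M : forall (c : C) (N s : nat) (w : C),
  (0 < s < S N)%nat -> Cpow w (S N) = 1 ->
  (forall s : nat, (0 < s < S N)%nat -> Cpow w s <> 1) ->
  sum_n (fun j => Cpow (r * Cpow w j) s * c)%C N = RtoC 0).
{ intros c N s w Hs HN Hw.
  rewrite (sum_n_ext _ (fun j => mult (Cpow r s * c)%C (Cpow (Cpow w s) j))).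
  2:{ intros j; change mult with Cmult.
      rewrite Cpow_mult_l, <- !Cpow_mult_r, (Nat.mul_comm j s); cring. }
  rewrite sum_n_mult_l.
  change (Cpow r s * c * sum_n (fun j => Cpow (Cpow w s) j) N = 0)%C.
  assert (E := geometric_sum (Cpow w s) N).
  rewrite <- Cpow_mult_r, Nat.mul_comm, Cpow_mult_r, HN, Cpow_1_l in E.
  destruct (Ceq_dec (sum_n (fun j => Cpow (Cpow w s) j) N) 0) as [Z | Z].
  - rewrite Z; cring.
  - exfalso; apply (Hw s Hs).
    assert (E' : (Cpow w s - 1 = 0)%C).
    { set (T := sum_n _ N) in *; transitivity ((Cpow w s - 1) * T / T)%C;
        [now field | rewrite E; now field]. }
    replace (Cpow w s) with (Cpow w s - 1 + 1)%C by ring; rewrite E'; ring. }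
induction 1 as [F c Hc | F c G HG [d IH] Hc].
- exists 0%nat; intros N s w H0 H1 H2 H3.
  rewrite <- (M c N s w) by (assumption || lia).
  apply sum_n_ext; intros j; now rewrite Hc.
- exists (S d); intros N s w H0 H1 H2 H3.
  rewrite (sum_n_ext _ (fun j => plus (Cpow (r * Cpow w j) s * c)%C
     (Cpow (r * Cpow w j) (S s) * G (r * Cpow w j))%C)).
  2:{ intros j; change plus with Cplus; rewrite Hc, Cpow_S; cring. }
  rewrite sum_n_plus, M, IH by (assumption || lia).
  change plus with Cplus; cring.
Qed.

Lemma Re_sum_n_le (u : nat -> C) (K : R) (n : nat) :
  (forall j, Re (u j) <= K) -> Re (sum_n u n) <= INR (S n) * K.
Proof.
intros H; induction n as [|n IH].
- rewrite sum_O; simpl; rewrite Rmult_1_l; apply H.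
- rewrite sum_Sn, S_INR; change (Re (plus (sum_n u n) (u (S n))))
    with (Re (sum_n u n) + Re (u (S n))).
  specialize (H (S n)); lra.
Qed.

(* A polynomial without constant term averages to 0 over the roots of unity. *)
Lemma Re_bound_nonneg (r K : R) (F : C -> C) :
  0 < r -> polynomial F ->
  (forall z, Cmod z = r -> Re (z * F z) <= K) -> 0 <= K.
Proof.
intros Hr HF HK.
destruct (mean_zero r F HF) as [d Hd].
destruct (primitive_root (S d)) as [w [Hw1 [HwN Hw]]].
assert (E := Hd (S d) 1%nat w ltac:(lia) ltac:(lia) HwN Hw).
assert (L : Re (sum_n (fun j => Cpow (r * Cpow w j) 1 * F (r * Cpow w j))%C (S d))
  <= INR (S (S d)) * K).
{ apply Re_sum_n_le; intros j; rewrite Cpow_1_r; apply HK.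
  rewrite Cmod_mult, Cmod_R, Cmod_pow, Hw1, pow1, Rabs_pos_eq; lra. }
rewrite E in L; change (Re 0) with 0 in L.
assert (0 < INR (S (S d))) by (apply lt_0_INR; lia); nra.
Qed.

Lemma Cmod_sqr (z : C) : Cmod z * Cmod z = fst z * fst z + snd z * snd z.
Proof. generalize (Cmod2_alt z); unfold Re, Im; simpl; lra. Qed.

(** On |z| = r the right side minus the left side of the hypothesis is [D] - 2 Re (z F(z)) - |z^2
    H|^2 for a polynomial F; the cross term of y z with z^2 H is polynomial because conj(z) z^2 =
    r^2 z. Dropping the last square leaves Re (z F) <= D/2, to which [Re_bound_nonneg] applies. *)
Lemma bessel (r m : R) (x y b : C) (H : C -> C) :
  0 < r -> polynomial H ->
  (forall z, Cmod z = r ->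
     Cmod (x + y * z + z * z * H z) * Cmod (x + y * z + z * z * H z) <=
     m * (Cmod (1 + b * z) * Cmod (1 + b * z))) ->
  Cmod x * Cmod x + r * r * (Cmod y * Cmod y) <= m * (1 + r * r * (Cmod b * Cmod b)).
Proof.
intros Hr HH Hz.
set (D := m * (1 + r * r * (Cmod b * Cmod b)) -
          (Cmod x * Cmod x + r * r * (Cmod y * Cmod y))).
enough (0 <= D / 2) by (unfold D in *; lra).
set (r2 := RtoC (r * r)).
apply (Re_bound_nonneg r _ (fun z => Cconj x * y + - (m * b) +
   (Cconj x * (z * H z) + (r2 * Cconj y) * H z))%C Hr).
- apply polynomial_plus; [apply polynomial_cst |].
  apply polynomial_plus; apply polynomial_scal; [|assumption].
  apply polynomial_mult; [apply polynomial_id | assumption].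
- intros z E; specialize (Hz z E); unfold D, r2.
  replace (r * r) with (Cmod z * Cmod z) in * by (now rewrite E).
  rewrite !Cmod_sqr in *.
  set (h := H z) in *; clearbody h.
  destruct x as [x1 x2], y as [y1 y2], b as [b1 b2], z as [z1 z2], h as [h1 h2].
  unfold Re, Cconj, Cplus, Cmult, Copp, RtoC in *; simpl in *.
  (* This is |z^2 h|^2, the only term that is discarded. *)
  assert (P : 0 <= ((z1 * z1 - z2 * z2) * h1 - (z1 * z2 + z2 * z1) * h2)^2 +
     ((z1 * z1 - z2 * z2) * h2 + (z1 * z2 + z2 * z1) * h1)^2)
    by (generalize (pow2_ge_0 ((z1 * z1 - z2 * z2) * h1 - (z1 * z2 + z2 * z1) * h2))
     (pow2_ge_0 ((z1 * z1 - z2 * z2) * h2 + (z1 * z2 + z2 * z1) * h1)); lra).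
  lra.
Qed.

Notation sums_to a z l := (@is_pseries C_AbsRing C_NormedModule a (z : C) (l : C)).

(** * Complex power series *)

(** Counts n terms, whereas [sum_n] up to n has n + 1. The Horner recursion makes each partial sum a
    [polynomial] at once and lets [simpl] expose the leading coefficients. *)
Fixpoint psum (a : nat -> C) (n : nat) (z : C) : C :=
  match n with
  | O => 0
  | S m => a 0%nat + z * psum (fun k => a (S k)) m z
  end.

Lemma psum_S (a : nat -> C) (n : nat) (z : C) :
  psum a (S n) z = (psum a n z + a n * Cpow z n)%C.
Proof.
revert a; induction n as [|n IH]; intros a; [simpl; ring |].
change (psum a (S (S n)) z) with (a 0%nat + z * psum (fun k => a (S k)) (S n) z)%C.
rewrite IH; simpl; ring.
Qed.

Lemma polynomial_psum (a : nat -> C) (n : nat) : polynomial (psum a n).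
Proof.
revert a; induction n as [|n IH]; intros a; [exact (polynomial_cst 0) |].
now apply (polynomial_step _ (a 0%nat) _ (IH (fun k => a (S k)))).
Qed.

Lemma pow_n_Cpow (z : C) (n : nat) : @pow_n C_AbsRing z n = Cpow z n.
Proof.
induction n as [|n IH]; [reflexivity |].
rewrite Cpow_S, <- IH; reflexivity.
Qed.

Lemma sum_n_psum (a : nat -> C) (n : nat) (z : C) :
  @sum_n C_NormedModule (fun k => scal (@pow_n C_AbsRing z k) (a k)) n = psum a (S n) z.
Proof.
induction n as [|n IH].
- rewrite sum_O; change (1 * a 0%nat = psum a 1 z)%C; simpl; ring.
- rewrite sum_Sn, IH, (psum_S a (S n)), pow_n_Cpow.
  change (psum a (S n) z + Cpow z (S n) * a (S n) =
          psum a (S n) z + a (S n) * Cpow z (S n))%C; ring.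
Qed.

Lemma is_pseries_psum (a : nat -> C) (z l : C) :
  sums_to a z l <->
  forall eps, 0 < eps ->
    exists N, forall n, (N <= n)%nat -> Cmod (psum a n z - l) < eps.
Proof.
unfold is_pseries, is_series.
rewrite (@filterlim_locally_ball_norm C_AbsRing nat C_NormedModule eventually _).
split; intros H.
- intros eps Heps; destruct (H (mkposreal eps Heps)) as [N HN].
  exists (S N); intros [|n] Hn; [lia |].
  specialize (HN n ltac:(lia)); unfold ball_norm in HN.
  rewrite sum_n_psum in HN; exact HN.
- intros eps; destruct (H eps (cond_pos eps)) as [N HN].
  exists N; intros n Hn; unfold ball_norm; rewrite sum_n_psum.
  apply HN; lia.
Qed.

Lemma bounded_of_eventually (u : nat -> R) (B : R) (N : nat) :
  (forall n, (N <= n)%nat -> u n <= B) -> exists M, forall n, u n <= M.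
Proof.
revert B; induction N as [|N IH]; intros B H.
- exists B; intros n; apply H; lia.
- apply (IH (Rmax B (u N))); intros n Hn.
  destruct (Nat.eq_dec n N) as [-> | E]; [apply Rmax_r |].
  apply Rle_trans with (2 := Rmax_l _ _); apply H; lia.
Qed.

(* Equivalent to a radius of convergence at least 1. *)
Definition tame (a : nat -> C) : Prop :=
  forall rho, 0 < rho < 1 -> exists M, forall n, Cmod (a n) * rho ^ n <= M.

(** At z = rho a term is the difference of two consecutive partial sums, hence eventually below 2.
    The origin is left out because the quotient g(z)/z is known to be the sum only away from it. *)
Lemma tame_of_pseries (a : nat -> C) (f : C -> C) :
  (forall z : C, z <> 0 -> in_disk z -> sums_to a z (f z)) ->
  tame a.
Proof.
intros H rho Hr.
assert (Hz : Cmod rho = rho) by (rewrite Cmod_R, Rabs_pos_eq; lra).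
assert (Hs : sums_to a (RtoC rho) (f rho)).
{ apply H; [| unfold in_disk; lra].
  apply Cmod_gt_0; lra. }
destruct (proj1 (is_pseries_psum _ _ _) Hs 1 Rlt_0_1) as [N HN].
apply (bounded_of_eventually _ 2 N); intros n Hn.
rewrite <- Hz, <- Cmod_pow, <- Cmod_mult.
replace (a n * Cpow rho n)%C with
  ((psum a (S n) rho - f rho) + - (psum a n rho - f rho))%C by (rewrite psum_S; ring).
apply Rle_trans with (1 := Cmod_triangle _ _); rewrite Cmod_opp.
generalize (HN n Hn) (HN (S n) ltac:(lia)); lra.
Qed.

(** Keeping the subtracted q^m makes the geometric tail bound inductive in m; the factor 1 - q on
    the left replaces a division. *)
Lemma psum_Cauchy (a : nat -> C) (M q : R) (z : C) :
  0 <= q < 1 -> (forall n, Cmod (a n * Cpow z n) <= M * q ^ n) ->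
  forall n m, (n <= m)%nat ->
    Cmod (psum a m z - psum a n z) * (1 - q) <= M * (q ^ n - q ^ m).
Proof.
intros Hq H n m Hnm; induction Hnm as [|m Hnm IH].
- replace (psum a n z - psum a n z)%C with (RtoC 0) by ring; rewrite Cmod_0; lra.
- rewrite psum_S.
  replace (psum a m z + a m * Cpow z m - psum a n z)%C with
    ((psum a m z - psum a n z) + a m * Cpow z m)%C by ring.
  generalize (Cmod_triangle (psum a m z - psum a n z) (a m * Cpow z m)) (H m); simpl; nra.
Qed.

(** Weierstrass majorant: with rho midway between r and 1, a bound on |a_n| rho^n gives geometric
    decay of ratio r / rho. *)
Lemma tame_geometric (a : nat -> C) (r : R) :
  tame a -> 0 < r < 1 -> exists M q, 0 < q < 1 /\ 0 <= M /\
    forall n z, Cmod z <= r -> Cmod (a n * Cpow z n) <= M * q ^ n.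
Proof.
intros Ha Hr; destruct (Ha ((1 + r) / 2) ltac:(lra)) as [M HM].
set (rho := (1 + r) / 2) in *.
assert (Hrho : 0 < rho) by (unfold rho; lra).
exists M, (r / rho); split; [split |split].
- apply Rdiv_lt_0_compat; lra.
- apply Rmult_lt_reg_r with rho; [lra |].
  unfold Rdiv; rewrite Rmult_assoc, Rinv_l; unfold rho; lra.
- generalize (HM 0%nat) (Cmod_ge_0 (a 0%nat)); simpl; lra.
- intros n z Hz; rewrite Cmod_mult, Cmod_pow.
  apply Rle_trans with (Cmod (a n) * r ^ n).
  { apply Rmult_le_compat_l; [apply Cmod_ge_0 |].
    apply pow_incr; split; [apply Cmod_ge_0 | assumption]. }
  replace (r ^ n) with (rho ^ n * (r / rho) ^ n)
    by (rewrite <- Rpow_mult_distr; f_equal; field; lra).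
  rewrite <- Rmult_assoc; apply Rmult_le_compat_r; [| apply HM].
  apply pow_le; apply Rlt_le, Rdiv_lt_0_compat; lra.
Qed.

Lemma psum_uniform (a : nat -> C) (r eps : R) :
  tame a -> 0 < r < 1 -> 0 < eps ->
  exists N, forall n z l, (N <= n)%nat -> Cmod z <= r ->
    sums_to a z l -> Cmod (psum a n z - l) <= eps.
Proof.
intros Ha Hr Heps.
destruct (tame_geometric a r Ha Hr) as [M [q [Hq [HM H]]]].
(* The tail after n terms is at most M q^n / (1 - q), and this threshold puts it below eps/2; M + 1
   keeps the denominator positive when M = 0. *)
destruct (pow_lt_1_zero q ltac:(rewrite Rabs_pos_eq; lra)
  (eps / 2 * (1 - q) / (M + 1))) as [N HN].
{ apply Rdiv_lt_0_compat; [apply Rmult_lt_0_compat |]; lra. }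
exists N; intros n z l Hn Hz Hl.
destruct (proj1 (is_pseries_psum _ _ _) Hl (eps / 2) ltac:(lra)) as [N' HN'].
set (m := Nat.max n N'); specialize (HN' m ltac:(lia)); specialize (HN n Hn).
replace (psum a n z - l)%C with
  (- (psum a m z - psum a n z) + (psum a m z - l))%C by ring.
apply Rle_trans with (1 := Cmod_triangle _ _); rewrite Cmod_opp.
generalize (psum_Cauchy a M q z ltac:(lra) (fun n => H n z Hz) n m ltac:(lia)); intros HC.
assert (Hqm : 0 <= q ^ m) by (apply pow_le; lra).
assert (Hqn : 0 <= q ^ n) by (apply pow_le; lra).
rewrite Rabs_pos_eq in HN by assumption.
assert (q ^ n * (M + 1) < eps / 2 * (1 - q)).
{ replace (eps / 2 * (1 - q)) with (eps / 2 * (1 - q) / (M + 1) * (M + 1)) by (field; lra).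
  apply Rmult_lt_compat_r; lra. }
assert (Cmod (psum a m z - psum a n z) <= eps / 2); [| lra].
apply Rmult_le_reg_r with (1 - q); nra.
Qed.

(** If e = |a_0| were positive, the partial sums on |z| = 1/2 would be uniformly at most e/2 from
    some index on, while conj(a_0) times a partial sum has mean e^2 on that circle. The value at 0
    is thus never consulted. *)
Lemma pseries_zero_coef0 (a : nat -> C) :
  (forall z : C, z <> 0 -> in_disk z -> sums_to a z 0) ->
  a 0%nat = 0.
Proof.
intros H; apply Cmod_eq_0.
destruct (Req_dec (Cmod (a 0%nat)) 0) as [E | E]; [assumption | exfalso].
assert (P : 0 < Cmod (a 0%nat)) by (generalize (Cmod_ge_0 (a 0%nat)); lra).
set (e := Cmod (a 0%nat)) in *.
destruct (psum_uniform a (/ 2) (e / 2) (tame_of_pseries a (fun _ => 0) H)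
  ltac:(lra) ltac:(lra)) as [N HN].
assert (0 <= e * (e / 2) - e * e); [| nra].
apply (Re_bound_nonneg (/ 2) _
  (fun z => Cconj (a 0%nat) * psum (fun k => a (S k)) N z)%C ltac:(lra)).
- apply polynomial_scal, polynomial_psum.
- intros z Hz.
  assert (B : Cmod (psum a (S N) z - 0) <= e / 2).
  { apply HN; [lia | lra |]; apply H; [apply Cmod_gt_0; lra | unfold in_disk; lra]. }
  set (Q := psum (fun k => a (S k)) N z).
  assert (B' : Re (Cconj (a 0%nat) * (a 0%nat + z * Q)) <= e * (e / 2)).
  { apply Rle_trans with (1 := Rle_abs _); apply Rle_trans with (1 := re_le_Cmod _).
    rewrite Cmod_mult, Cmod_conj; apply Rmult_le_compat_l; [lra |].
    replace (a 0%nat + z * Q)%C with (psum a (S N) z - 0)%C by (simpl; unfold Q; ring).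
    assumption. }
  generalize (Cmod_sqr (a 0%nat)); fold e; intros ->.
  revert B'; destruct (a 0%nat) as [a1 a2], z as [z1 z2], Q as [q1 q2].
  unfold Re, Cconj, Cplus, Cmult; simpl; lra.
Qed.

(** Division by z shifts the coefficients, and the hypothesis survives it because it leaves out z =
    0. *)
Lemma pseries_zero_coef (a : nat -> C) :
  (forall z : C, z <> 0 -> in_disk z -> sums_to a z 0) ->
  forall n, a n = 0.
Proof.
intros H n; revert a H; induction n as [|n IH]; intros a H;
  [now apply pseries_zero_coef0 |].
apply (IH (fun k => a (S k))); intros z Hz0 Hz.
assert (E := is_pseries_decr_1 a z (/ z)%C (RtoC 0) (Cinv_l z Hz0) (H z Hz0 Hz)).
rewrite (pseries_zero_coef0 a H) in E.
replace (RtoC 0) with (@scal C_AbsRing C_NormedModule (/ z)%C (plus (RtoC 0) (opp (RtoC 0))));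
  [exact E |].
change (/ z * (0 + - 0) = 0)%C; ring.
Qed.

Lemma disk_series_unique (s t : nat -> C) (f : C -> C) :
  disk_series s f -> disk_series t f -> forall n, s n = t n.
Proof.
intros Hs Ht n.
assert (E : (s n - t n)%C = 0).
{ apply (pseries_zero_coef (fun n => s n - t n)%C); intros z _ Hz.
  assert (E := is_pseries_minus s t z (f z) (f z) (Hs z Hz) (Ht z Hz)).
  change (sums_to (fun n => s n - t n)%C z (f z - f z)%C) in E.
  now replace (f z - f z)%C with (RtoC 0) in E by ring. }
replace (s n) with (s n - t n + t n)%C by ring; rewrite E; ring.
Qed.

(** * The coefficient inequality *)

(** [w1] and [w2] are the first two coefficients of w = p^2 - 1. On |z| = r a partial sum P stands
    in for p, [bessel] is applied to (1 + b z) (P^2 - 1) / z, and r tends to 1. *)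
Lemma square_disk_parseval (q : nat -> C) (p : C -> C) (b : C) :
  (forall z : C, z <> 0 -> in_disk z -> sums_to q z (p z)) ->
  q 0%nat = 1 ->
  (forall z : C, z <> 0 -> in_disk z -> Cmod (p z * p z - 1) < 1) ->
  let w1 := (2 * q 1%nat)%C in
  let w2 := (2 * q 2%nat + q 1%nat * q 1%nat)%C in
  Cmod w1 * Cmod w1 + Cmod (w2 + b * w1) * Cmod (w2 + b * w1) <= 1 + Cmod b * Cmod b.
Proof.
intros Hp Hq0 Hw w1 w2.
set (X := Cmod w1 * Cmod w1 + Cmod (w2 + b * w1) * Cmod (w2 + b * w1)).
set (Y := 1 + Cmod b * Cmod b).
assert (X0 : 0 <= X) by (unfold X; nra).
assert (Y1 : 1 <= Y) by (unfold Y; nra).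
assert (Main : forall r, 0 < r < 1 -> r ^ 4 * X <= (2 - r) ^ 2 * Y).
{ intros r Hr.
  (* With |P - p| <= (1 - r)/5 and |p| <= 2, |P^2 - p^2| <= |P - p| (|P - p| + 4) <= 1 - r; hence
     |P^2 - 1| <= 2 - r. *)
  destruct (psum_uniform q r ((1 - r) / 5) (tame_of_pseries q p Hp) Hr ltac:(lra))
    as [N HN].
  set (G := psum (fun k => q (S (S (S k)))) N).
  (* The remainder in P^2 - 1 = z (w1 + w2 z + z^2 H1). Multiplying the bracket by 1 + b z turns it
     into b w2 + (1 + b z) H1. *)
  set (H1 := fun z => (2 * G z + (2 * q 1%nat) * (q 2%nat + z * G z) +
     z * ((q 2%nat + z * G z) * (q 2%nat + z * G z)))%C).
  assert (PG : polynomial G) by apply polynomial_psum.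
  assert (PQ : polynomial (fun z => q 2%nat + z * G z)%C)
    by now apply (polynomial_step _ (q 2%nat) G).
  assert (PH : polynomial (fun z => b * w2 + (1 + b * z) * H1 z)%C).
  { apply polynomial_plus; [apply polynomial_cst |].
    apply polynomial_mult.
    - apply polynomial_plus; [apply polynomial_cst |].
      apply polynomial_scal, polynomial_id.
    - unfold H1; apply polynomial_plus; [apply polynomial_plus |].
      + now apply polynomial_scal.
      + now apply polynomial_scal.
      + apply polynomial_mult; [apply polynomial_id | now apply polynomial_mult]. }
  assert (B := bessel r ((2 - r) ^ 2 / (r * r)) w1 (w2 + b * w1) b _ (proj1 Hr) PH).
  assert (B' : Cmod w1 * Cmod w1 + r * r * (Cmod (w2 + b * w1) * Cmod (w2 + b * w1)) <=
    (2 - r) ^ 2 / (r * r) * (1 + r * r * (Cmod b * Cmod b))).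
  { apply B; intros z Hz; clear B.
    assert (Hz0 : z <> 0) by (apply Cmod_gt_0; lra).
    assert (Hzd : in_disk z) by (unfold in_disk; lra).
    specialize (Hw z Hz0 Hzd).
    specialize (HN (S (S (S N))) z (p z) ltac:(lia) ltac:(lra) (Hp z Hz0 Hzd)).
    set (P := psum q (S (S (S N))) z) in *.
    assert (EP : P = (1 + z * (q 1%nat + z * (q 2%nat + z * G z)))%C)
      by (unfold P; simpl; now rewrite Hq0).
    assert (Bp : Cmod (p z) <= 2).
    { assert (Cmod (p z) * Cmod (p z) <= 2).
      { rewrite <- Cmod_mult.
        replace (p z * p z)%C with ((p z * p z - 1) + 1)%C by ring.
        apply Rle_trans with (1 := Cmod_triangle _ _); rewrite Cmod_1; lra. }
      generalize (Cmod_ge_0 (p z)); nra. }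
    assert (BP : Cmod (P * P - 1) <= 2 - r).
    { replace (P * P - 1)%C with ((P - p z) * ((P - p z) + 2 * p z) + (p z * p z - 1))%C
        by ring.
      apply Rle_trans with (1 := Cmod_triangle _ _); rewrite Cmod_mult.
      generalize (Cmod_triangle (P - p z) (2 * p z)); rewrite Cmod_mult, Cmod_R.
      rewrite (Rabs_pos_eq 2) by lra.
      generalize (Cmod_ge_0 (P - p z)) (Cmod_ge_0 (P - p z + 2 * p z)); nra. }
    assert (E : (z * (w1 + (w2 + b * w1) * z + z * z * (b * w2 + (1 + b * z) * H1 z)) =
      (1 + b * z) * (P * P - 1))%C) by (rewrite EP; unfold w1, w2, H1; ring).
    apply (f_equal Cmod) in E; rewrite !Cmod_mult, Hz in E.
    set (V := Cmod (w1 + _ + _)) in *; set (U := Cmod (1 + b * z)) in *.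
    assert (HU : 0 <= U) by apply Cmod_ge_0.
    assert (HP : 0 <= Cmod (P * P - 1)) by apply Cmod_ge_0.
    apply Rmult_le_reg_l with (r * r); [nra |].
    replace (r * r * ((2 - r) ^ 2 / (r * r) * (U * U))) with
      ((U * (2 - r)) * (U * (2 - r))) by (field; lra).
    replace (r * r * (V * V)) with ((r * V) * (r * V)) by ring; rewrite E.
    apply Rmult_le_compat; nra. }
  apply (Rmult_le_compat_l (r * r)) in B'; [| nra].
  replace (r * r * ((2 - r) ^ 2 / (r * r) * (1 + r * r * (Cmod b * Cmod b)))) with
    ((2 - r) ^ 2 * (1 + r * r * (Cmod b * Cmod b))) in B' by (field; lra).
  apply Rle_trans with
    (r * r * (Cmod w1 * Cmod w1 + r * r * (Cmod (w2 + b * w1) * Cmod (w2 + b * w1)))).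
  - unfold X.
    assert (0 <= r * r * (1 - r * r) * (Cmod w1 * Cmod w1))
      by (repeat apply Rmult_le_pos; try apply Cmod_ge_0; nra).
    replace (r ^ 4) with (r * r * (r * r)) by ring; lra.
  - apply Rle_trans with (1 := B'); apply Rmult_le_compat_l; [apply pow2_ge_0 |].
    unfold Y; apply Rplus_le_compat_l.
    rewrite <- (Rmult_1_l (Cmod b * Cmod b)) at 2; apply Rmult_le_compat_r; nra. }
destruct (Rle_lt_dec X Y) as [L | L]; [assumption | exfalso].
(* At r = 1 - e the estimate yields (1 - 4e) X <= (1 + 3e) Y, so X - Y <= 7 e X, against X - Y = 8 e
   X. *)
set (e := (X - Y) / (8 * X)).
assert (He : e * (8 * X) = X - Y) by (unfold e; field; lra).
assert (He0 : 0 < e) by (apply Rdiv_lt_0_compat; lra).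
assert (He1 : e < 1) by nra.
specialize (Main (1 - e) ltac:(lra)).
assert (A1 : 1 - 4 * e <= (1 - e) ^ 4) by (simpl; nra).
assert (A2 : (2 - (1 - e)) ^ 2 <= 1 + 3 * e) by (simpl; nra).
assert ((1 - 4 * e) * X <= (1 + 3 * e) * Y); [| nra].
apply Rle_trans with (1 := Rmult_le_compat_r X _ _ X0 A1).
apply Rle_trans with (1 := Main); apply Rmult_le_compat_r; lra.
Qed.

(** Once |w2| <= 1 - x with x = |w1|^2, the triangle inequality gives (1 - x) + |nu| x, a convex
    combination of 1 and |nu|. *)
Lemma coef_bound_of_parseval (w1 w2 nu : C) :
  (forall b, Cmod w1 * Cmod w1 + Cmod (w2 + b * w1) * Cmod (w2 + b * w1) <=
     1 + Cmod b * Cmod b) ->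
  Cmod (w2 - nu * (w1 * w1)) <= Rmax 1 (Cmod nu).
Proof.
intros H.
set (x := Cmod w1 * Cmod w1) in *; set (y := Cmod w2).
assert (x0 : 0 <= x) by (unfold x; nra).
assert (y0 : 0 <= y) by apply Cmod_ge_0.
assert (H0 : x + y * y <= 1).
{ specialize (H 0); rewrite Cmod_0 in H.
  replace (w2 + 0 * w1)%C with w2 in H by ring; fold y in H; lra. }
assert (Hy : y <= 1 - x).
{ destruct (Req_dec x 1) as [E | E]; [nra |].
  (* The norm of the contraction [[w1, 0], [w2, w1]] is tested on the vector
     (1, t conj(w1) w2), whose best choice of t is 1 / (1 - |w1|^2). *)
  set (t := / (1 - x)).
  assert (Ht : t * (1 - x) = 1) by (unfold t; field; lra).
  specialize (H (t * (Cconj w1 * w2))%C).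
  replace (w2 + t * (Cconj w1 * w2) * w1)%C with (w2 * (1 + t * (w1 * Cconj w1)))%C
    in H by ring.
  rewrite <- Cmod2_conj in H.
  replace (Cmod w1 ^ 2) with x in H by (unfold x; ring).
  rewrite !Cmod_mult, Cmod_conj, Cmod_R in H.
  rewrite <- RtoC_mult, <- RtoC_plus, Cmod_R in H.
  assert (t0 : 0 < t) by (apply Rinv_0_lt_compat; nra).
  rewrite !Rabs_pos_eq in H by nra; fold y in H.
  replace (1 + t * x) with t in H by lra.
  replace (t * (Cmod w1 * y) * (t * (Cmod w1 * y))) with (t * t * x * (y * y)) in H
    by (unfold x; ring).
  (* As 1 + t x = t, [H] reads x + t^2 y^2 <= 1 + t^2 x y^2, and t (1 - x) = 1 reduces t^2 y^2 (1 -
     x) to t y^2. *)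
  assert (y * y * t <= 1 - x).
  { replace (y * t * (y * t)) with (y * y * t * (t * (1 - x)) + t * t * x * (y * y)) in H
      by ring.
    rewrite Ht in H; lra. }
  assert (y * y <= (1 - x) * (1 - x)) by nra.
  nra. }
unfold Cminus; apply Rle_trans with (1 := Cmod_triangle _ _).
rewrite Cmod_opp, !Cmod_mult; fold x y.
generalize (Rmax_l 1 (Cmod nu)) (Rmax_r 1 (Cmod nu)) (Cmod_ge_0 nu); nra.
Qed.

(** * Differentiability of power series *)

Lemma tame_le (a b : nat -> C) (K : R) :
  0 <= K -> (forall n, Cmod (b n) <= K * Cmod (a n)) -> tame a -> tame b.
Proof.
intros HK H Ha rho Hr; destruct (Ha rho Hr) as [M HM].
exists (K * M); intros n.
apply Rle_trans with (K * (Cmod (a n) * rho ^ n)).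
- rewrite <- Rmult_assoc; apply Rmult_le_compat_r; [apply pow_le; lra | apply H].
- now apply Rmult_le_compat_l.
Qed.

Lemma tame_shift (a : nat -> C) : tame a -> tame (fun n => a (S n)).
Proof.
intros Ha rho Hr; destruct (Ha rho Hr) as [M HM].
exists (M / rho); intros n.
apply Rmult_le_reg_r with rho; [lra |].
unfold Rdiv; rewrite (Rmult_assoc M), Rinv_l, Rmult_1_r by lra.
generalize (HM (S n)); simpl; lra.
Qed.

(** Each of the n + 1 terms of 1 + s + ... + s^n is at least s^n. *)
Lemma linear_times_geometric (s : R) (n : nat) :
  0 < s < 1 -> INR (S n) * s ^ n * (1 - s) <= 1 - s ^ S n.
Proof.
intros Hs; induction n as [|n IH]; [simpl; lra |].
rewrite S_INR; simpl pow in *.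
assert (0 <= s ^ n) by (apply pow_le; lra).
assert (s * (INR (S n) * s ^ n * (1 - s)) <= s * (1 - s * s ^ n))
  by (apply Rmult_le_compat_l; lra).
assert (s ^ n <= 1) by (rewrite <- (pow1 n); apply pow_incr; lra).
assert (s * s ^ n <= 1) by nra.
assert (s * s ^ n * (1 - s) <= 1 * (1 - s)) by (apply Rmult_le_compat_r; lra).
lra.
Qed.

(** With s = sqrt rho, rho^n = s^n s^n: one factor controls the coefficient, the other absorbs n +
    1. *)
Lemma tame_mult_INR (a : nat -> C) : tame a -> tame (fun n => INR (S n) * a n)%C.
Proof.
intros Ha rho Hr.
set (s := sqrt rho).
assert (Es : s * s = rho) by (apply sqrt_sqrt; lra).
assert (Hs0 : 0 < s) by (apply sqrt_lt_R0; lra).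
assert (Hs : 0 < s < 1) by nra.
destruct (Ha s Hs) as [M HM].
exists (M * / (1 - s)); intros n.
rewrite <- Es, Rpow_mult_distr, Cmod_mult, Cmod_R, Rabs_pos_eq by apply pos_INR.
assert (Hp : 0 <= s ^ n) by (apply pow_le; lra).
assert (INR (S n) * s ^ n <= / (1 - s)).
{ apply Rmult_le_reg_r with (1 - s); [lra |].
  rewrite Rinv_l by lra.
  apply Rle_trans with (1 := linear_times_geometric s n Hs).
  generalize (pow_le s (S n)); lra. }
replace (INR (S n) * Cmod (a n) * (s ^ n * s ^ n)) with
  ((Cmod (a n) * s ^ n) * (INR (S n) * s ^ n)) by ring.
apply Rmult_le_compat; [| | apply HM | assumption].
- apply Rmult_le_pos; [apply Cmod_ge_0 | assumption].
- apply Rmult_le_pos; [apply pos_INR | assumption].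
Qed.

Lemma tame_sums (a : nat -> C) (z : C) : tame a -> in_disk z -> exists l : C, sums_to a z l.
Proof.
intros Ha Hz; unfold in_disk in Hz.
destruct (tame_geometric a ((1 + Cmod z) / 2) Ha) as [M [q [Hq [HM H]]]].
{ generalize (Cmod_ge_0 z); lra. }
apply (@ex_series_le C_AbsRing C_CompleteNormedModule _ (fun n => M * q ^ n)).
- intros n; rewrite pow_n_Cpow.
  change (Cmod (Cpow z n * a n) <= M * q ^ n).
  rewrite Cmult_comm; apply H; lra.
- apply (@ex_series_scal R_AbsRing R_NormedModule M (fun n => q ^ n)), ex_series_geom.
  rewrite Rabs_pos_eq; lra.
Qed.

Lemma ex_derive_of_quadratic_remainder (f : C -> C) (z0 l : C) (d K : R) :
  0 < d ->
  (forall z, Cmod (z - z0) < d ->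
     Cmod (f z - f z0 - (z - z0) * l) <= K * (Cmod (z - z0) * Cmod (z - z0))) ->
  @ex_derive C_AbsRing C_NormedModule f z0.
Proof.
intros Hd H; exists l; split; [apply is_linear_scal_l |].
intros x Hx eps.
rewrite <- (@is_filter_lim_locally_unique C_AbsRing (AbsRing_NormedModule C_AbsRing) z0 x Hx).
clear x Hx.
assert (HK : 0 < Rabs K + 1) by (generalize (Rabs_pos K); lra).
assert (He : 0 < Rmin d (eps / (Rabs K + 1))).
{ apply Rmin_pos; [assumption |]; apply Rdiv_lt_0_compat; [apply cond_pos | assumption]. }
exists (mkposreal _ He); intros z Hz.
change (Cmod (z - z0) < Rmin d (eps / (Rabs K + 1))) in Hz.
change (Cmod (f z - f z0 - (z - z0) * l) <= eps * Cmod (z - z0)).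
apply Rle_trans with (1 := H z (Rlt_le_trans _ _ _ Hz (Rmin_l _ _))).
assert (Hz2 := Rlt_le_trans _ _ _ Hz (Rmin_r _ _)).
rewrite <- Rmult_assoc; apply Rmult_le_compat_r; [apply Cmod_ge_0 |].
assert (Cmod (z - z0) * (Rabs K + 1) < eps).
{ replace (pos eps) with (eps / (Rabs K + 1) * (Rabs K + 1)) by (field; lra).
  now apply Rmult_lt_compat_r. }
generalize (Rle_abs K) (Cmod_ge_0 (z - z0)); nra.
Qed.

(** The two bounds go together, since the second-order remainder of z^(n+2) is z0 times that of
    z^(n+1) plus z - z0 times a first-order difference. The factor rho on the left avoids the
    exponent n - 1. *)
Lemma Cpow_taylor (z z0 : C) (rho : R) (n : nat) :
  Cmod z <= rho -> Cmod z0 <= rho -> 0 < rho ->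
  Cmod (Cpow z (S n) - Cpow z0 (S n)) <= INR (S n) * rho ^ n * Cmod (z - z0) /\
  rho * Cmod (Cpow z (S n) - Cpow z0 (S n) - INR (S n) * Cpow z0 n * (z - z0)) <=
    INR (S n) * INR (S n) * rho ^ n * (Cmod (z - z0) * Cmod (z - z0)).
Proof.
intros Hz Hz0 Hrho; induction n as [|n [IH1 IH2]].
- split.
  + rewrite !Cpow_1_r; simpl; lra.
  + replace (Cpow z 1 - Cpow z0 1 - INR 1 * Cpow z0 0 * (z - z0))%C with (RtoC 0)
      by (simpl; ring).
    rewrite Cmod_0; generalize (Cmod_ge_0 (z - z0)); simpl; nra.
- set (N := S n) in *; set (d := Cmod (z - z0)) in *.
  assert (d0 : 0 <= d) by apply Cmod_ge_0.
  assert (P0 : 0 <= rho ^ n) by (apply pow_le; lra).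
  assert (N0 : 0 <= INR N) by apply pos_INR.
  rewrite (S_INR N), RtoC_plus.
  assert (PN : rho ^ N = rho * rho ^ n) by reflexivity.
  split.
  + replace (Cpow z (S N) - Cpow z0 (S N))%C with
      (z * (Cpow z N - Cpow z0 N) + Cpow z0 N * (z - z0))%C by (rewrite !Cpow_S; ring).
    apply Rle_trans with (1 := Cmod_triangle _ _); rewrite !Cmod_mult, Cmod_pow; fold d.
    assert (Cmod z * Cmod (Cpow z N - Cpow z0 N) <= rho * (INR N * rho ^ n * d))
      by (apply Rmult_le_compat; auto using Cmod_ge_0).
    assert (Cmod z0 ^ N * d <= rho ^ N * d).
    { apply Rmult_le_compat_r; [assumption |].
      apply pow_incr; split; [apply Cmod_ge_0 | assumption]. }
    rewrite PN in *; lra.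
  + replace (Cpow z (S N) - Cpow z0 (S N) - (INR N + 1) * Cpow z0 N * (z - z0))%C with
      (z0 * (Cpow z N - Cpow z0 N - INR N * Cpow z0 n * (z - z0)) +
       (z - z0) * (Cpow z N - Cpow z0 N))%C
      by (unfold N; rewrite !Cpow_S; ring).
    set (E := (_ - _ - INR N * Cpow z0 n * (z - z0))%C) in *.
    apply Rle_trans with (rho * (rho * Cmod E + d * (INR N * rho ^ n * d))).
    * apply Rmult_le_compat_l; [lra |].
      apply Rle_trans with (1 := Cmod_triangle _ _); rewrite !Cmod_mult; fold d.
      apply Rplus_le_compat; [apply Rmult_le_compat_r | apply Rmult_le_compat_l];
        auto using Cmod_ge_0.
    * rewrite PN.
      assert (rho * (rho * Cmod E) <= rho * (INR N * INR N * rho ^ n * (d * d)))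
        by (apply Rmult_le_compat_l; lra).
      assert (0 <= (INR N + 1) * (rho * rho ^ n) * (d * d)).
      { apply Rmult_le_pos; [apply Rmult_le_pos |]; nra. }
      nra.
Qed.

(** By [Cpow_taylor] the second-order remainder of each term costs a factor (n + 1)^2, which
    applying [tame_mult_INR] twice absorbs. The remainders then sum geometrically to a multiple of
    |z - z0|^2. *)
Lemma disk_series_analytic (a : nat -> C) (f : C -> C) :
  disk_series a f -> analytic_in_disk f.
Proof.
intros Hf z0 Hz0.
assert (Ta : tame a) by (apply (tame_of_pseries a f); auto).
set (a1 := fun n => a (S n)).
assert (T1 : tame (fun n => INR (S n) * a1 n)%C) by now apply tame_mult_INR, tame_shift.
assert (T2 := tame_mult_INR _ T1).
destruct (tame_sums _ z0 T1 Hz0) as [l Hl].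
unfold in_disk in Hz0.
set (rho := (1 + Cmod z0) / 2).
assert (Hrho : 0 < rho < 1) by (unfold rho; generalize (Cmod_ge_0 z0); lra).
destruct (tame_geometric _ rho T2 Hrho) as [M [q [Hq [HM H]]]].
apply (ex_derive_of_quadratic_remainder f z0 l (rho - Cmod z0) (M / (1 - q) / rho)).
{ unfold rho; lra. }
intros z Hz; set (d := Cmod (z - z0)) in *.
assert (d0 : 0 <= d) by apply Cmod_ge_0.
assert (Hzr : Cmod z <= rho).
{ replace z with ((z - z0) + z0)%C by ring.
  apply Rle_trans with (1 := Cmod_triangle _ _); fold d; lra. }
assert (Hz0r : Cmod z0 <= rho) by (unfold rho; lra).
(* The derivative of a partial sum with n + 1 terms has n terms. *)
set (R' := fun n => (psum a (S n) z - psum a (S n) z0 -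
   (z - z0) * psum (fun n => INR (S n) * a1 n) n z0)%C).
assert (HR : forall n, Cmod (R' n) * (1 - q) * rho <= M * (1 - q ^ n) * (d * d)).
{ induction n as [|n IH].
  - replace (R' 0%nat) with (RtoC 0) by (unfold R'; simpl; ring).
    rewrite Cmod_0; simpl; lra.
  - replace (R' (S n)) with (R' n + a1 n *
      (Cpow z (S n) - Cpow z0 (S n) - INR (S n) * Cpow z0 n * (z - z0)))%C
      by (unfold R'; rewrite !(psum_S _ (S n)),
            (psum_S (fun n => INR (S n) * a1 n)%C n);
          unfold a1; ring).
    set (E := (_ - _ - _)%C).
    assert (HE : rho * Cmod (a1 n * E) <= M * q ^ n * (d * d)).
    { destruct (Cpow_taylor z z0 rho n Hzr Hz0r ltac:(lra)) as [_ HE]; fold E d in HE.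
      assert (Hb := H n rho ltac:(rewrite Cmod_R, Rabs_pos_eq; lra)).
      rewrite !Cmod_mult, Cmod_pow, !Cmod_R, !(Rabs_pos_eq (INR _)), Rabs_pos_eq in Hb
        by (lra || apply pos_INR).
      rewrite Cmod_mult.
      apply Rle_trans with (Cmod (a1 n) *
        (INR (S n) * INR (S n) * rho ^ n * (d * d))).
      - replace (rho * (Cmod (a1 n) * Cmod E)) with (Cmod (a1 n) * (rho * Cmod E)) by ring.
        apply Rmult_le_compat_l; [apply Cmod_ge_0 | assumption].
      - replace (Cmod (a1 n) * (INR (S n) * INR (S n) * rho ^ n * (d * d))) with
          (INR (S n) * (INR (S n) * Cmod (a1 n)) * rho ^ n * (d * d)) by ring.
        apply Rmult_le_compat_r; [nra | assumption]. }
    assert (HT := Cmod_triangle (R' n) (a1 n * E)).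
    apply Rle_trans with (Cmod (R' n) * (1 - q) * rho +
       rho * Cmod (a1 n * E) * (1 - q)).
    + replace (Cmod (R' n) * (1 - q) * rho + rho * Cmod (a1 n * E) * (1 - q)) with
        ((Cmod (R' n) + Cmod (a1 n * E)) * ((1 - q) * rho)) by ring.
      rewrite Rmult_assoc; apply Rmult_le_compat_r; [nra | assumption].
    + apply (Rmult_le_compat_r (1 - q)) in HE; [| lra].
      simpl; lra. }
assert (HR' : forall n, Cmod (R' n) <= M / (1 - q) / rho * (d * d)).
{ intros n; apply Rmult_le_reg_r with ((1 - q) * rho); [nra |].
  rewrite <- Rmult_assoc; apply Rle_trans with (1 := HR n).
  replace (M / (1 - q) / rho * (d * d) * ((1 - q) * rho)) with (M * (d * d)) by (field; lra).
  assert (0 <= M * q ^ n * (d * d)); [| lra].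
  apply Rmult_le_pos; [apply Rmult_le_pos; [| apply pow_le] |]; nra. }
apply le_epsilon; intros eps Heps.
assert (Hzd : in_disk z) by (unfold in_disk; lra).
destruct (proj1 (is_pseries_psum _ _ _) (Hf z Hzd) (eps / 3) ltac:(lra)) as [N1 H1].
destruct (proj1 (is_pseries_psum _ _ _) (Hf z0 Hz0) (eps / 3) ltac:(lra)) as [N2 H2].
destruct (proj1 (is_pseries_psum _ _ _) Hl (eps / 3) ltac:(lra)) as [N3 H3].
set (n := (N1 + N2 + N3)%nat).
specialize (H1 (S n) ltac:(lia)); specialize (H2 (S n) ltac:(lia)).
specialize (H3 n ltac:(lia)); specialize (HR' n).
set (Q := psum (fun n => INR (S n) * a1 n)%C n z0) in *.
replace (f z - f z0 - (z - z0) * l)%C with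
  (R' n + ((- (psum a (S n) z - f z) + (psum a (S n) z0 - f z0)) + (z - z0) * (Q - l)))%C
  by (unfold R'; fold Q; ring).
apply Rle_trans with (1 := Cmod_triangle _ _); apply Rplus_le_compat; [assumption |].
apply Rle_trans with (1 := Cmod_triangle _ _); rewrite Cmod_mult; fold d.
generalize (Cmod_triangle (- (psum a (S n) z - f z)) (psum a (S n) z0 - f z0)).
rewrite Cmod_opp; generalize (Cmod_ge_0 (Q - l)).
assert (d <= 1) by (generalize (Cmod_ge_0 z0); lra).
nra.
Qed.

(** * The binomial series of the square root *)

Fixpoint binom_half (n : nat) : R :=
  match n with
  | O => 1
  | S m => binom_half m * (1 / 2 - INR m) / INR (S m)
  end.

Lemma binom_half_S (n : nat) :
  INR (S n) * binom_half (S n) = (1 / 2 - INR n) * binom_half n.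
Proof.
change (binom_half (S n)) with (binom_half n * (1 / 2 - INR n) / INR (S n)).
field; apply not_0_INR; lia.
Qed.

Lemma sum_f_R0_rev (u : nat -> R) (n : nat) :
  sum_f_R0 (fun i => u (n - i)%nat) n = sum_f_R0 u n.
Proof.
induction n as [|n IH]; [reflexivity |].
rewrite decomp_sum by lia; simpl Init.Nat.pred.
rewrite (sum_eq _ (fun i => u (n - i)%nat)) by (intros; f_equal; lia).
rewrite IH, Nat.sub_0_r; simpl; lra.
Qed.

Definition self_conv (n : nat) : R :=
  sum_f_R0 (fun i => binom_half i * binom_half (n - i)) n.

(* This is (1+z) (S^2)' = S^2 for the binomial series S; by symmetry the weight i
   can be replaced with n/2 in a sum over i + j = n. *)
Lemma self_conv_S (n : nat) :
  INR (S n) * self_conv (S n) = (1 - INR n) * self_conv n.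
Proof.
assert (W : forall m, 2 * sum_f_R0
  (fun i => INR i * (binom_half i * binom_half (m - i))) m = INR m * self_conv m).
{ intros m; unfold self_conv; rewrite (scal_sum _ m (INR m)).
  set (u := fun i => INR i * (binom_half i * binom_half (m - i))).
  replace (2 * sum_f_R0 u m) with (sum_f_R0 (fun i => u (m - i)%nat) m + sum_f_R0 u m)
    by (rewrite sum_f_R0_rev; ring).
  rewrite <- plus_sum; apply sum_eq; intros i Hi; unfold u.
  replace (m - (m - i))%nat with i by lia; rewrite minus_INR by lia; ring. }
rewrite <- W, decomp_sum by lia; simpl Init.Nat.pred.
rewrite (sum_eq _ (fun i => binom_half i * binom_half (n - i) * (1 / 2) -
   INR i * (binom_half i * binom_half (n - i)))).
- rewrite minus_sum, <- scal_sum; fold (self_conv n); specialize (W n).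
  simpl (INR 0); lra.
- intros i _; replace (S n - S i)%nat with (n - i)%nat by lia.
  rewrite <- Rmult_assoc, binom_half_S; ring.
Qed.

(** Only 1 + z survives in the Cauchy square: the coefficient of z^2 is computed, and the recurrence
    propagates its vanishing. *)
Lemma self_conv_SS (n : nat) : self_conv (S (S n)) = 0.
Proof.
assert (H : forall n, INR (S n) <> 0) by (intros; apply not_0_INR; lia).
induction n as [|n IH]; [unfold self_conv; simpl; field |].
generalize (self_conv_S (S (S n))) (H (S (S n))); rewrite IH, Rmult_0_r; nra.
Qed.

(** Writing b_k for the coefficients, the recurrence gives (2n + 1) |b_(n+1)| = (2n + 4) |b_(n+2)|,
    so adding |b_(n+2)| leaves 2 - (2n + 3) |b_(n+2)|. The bound 2 on all partial sums follows
    without passing to a limit. *)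
Lemma sum_abs_binom_half (n : nat) :
  sum_f_R0 (fun k => Rabs (binom_half k)) (S n) =
    2 - (2 * INR n + 1) * Rabs (binom_half (S n)).
Proof.
induction n as [|n IH].
- simpl; rewrite !Rabs_pos_eq by lra; lra.
- rewrite tech5, IH.
  assert (H : 0 < INR (S (S n))) by (apply lt_0_INR; lia).
  assert (E := binom_half_S (S n)).
  apply (f_equal Rabs) in E; rewrite !Rabs_mult, (Rabs_pos_eq _ (Rlt_le _ _ H)) in E.
  assert (H0 := pos_INR n).
  rewrite (Rabs_left (1 / 2 - _)) in E by (rewrite S_INR; lra).
  rewrite !S_INR in *; lra.
Qed.

Lemma sum_abs_binom_half_le (n : nat) :
  sum_f_R0 (fun k => Rabs (binom_half k)) n <= 2.
Proof.
destruct n as [|n]; [simpl; rewrite Rabs_R1; lra |].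
rewrite sum_abs_binom_half.
generalize (pos_INR n) (Rabs_pos (binom_half (S n))); nra.
Qed.

(** Every term beyond index m carries at least the power m + 1 of z. The estimate serves both for
    the tails in the Cauchy product and, with m = 0, for |S - 1| <= |z|. *)
Lemma psum_diff_le (s : nat -> R) (z : C) (m n : nat) :
  Cmod z <= 1 -> (m <= n)%nat ->
  Cmod (psum (fun k => RtoC (s k)) (S n) z - psum (fun k => RtoC (s k)) (S m) z) <=
    Cmod z ^ (S m) * (sum_f_R0 (fun k => Rabs (s k)) n - sum_f_R0 (fun k => Rabs (s k)) m).
Proof.
intros Hz Hmn; induction Hmn as [|n Hmn IH].
- rewrite Rminus_diag, Rmult_0_r.
  replace (_ - _)%C with (RtoC 0) by ring; rewrite Cmod_0; lra.
- rewrite psum_S, tech5.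
  set (P := psum _ (S n) z) in *; set (Q := psum _ (S m) z) in *.
  replace (P + s (S n) * Cpow z (S n) - Q)%C with
    ((P - Q) + s (S n) * Cpow z (S n))%C by ring.
  apply Rle_trans with (1 := Cmod_triangle _ _).
  rewrite Cmod_mult, Cmod_R, Cmod_pow.
  assert (Cmod z ^ S n <= Cmod z ^ S m).
  { replace (S n) with (S m + (n - m))%nat by lia; rewrite pow_add.
    rewrite <- (Rmult_1_r (Cmod z ^ S m)) at 2.
    apply Rmult_le_compat_l; [apply pow_le, Cmod_ge_0 |].
    rewrite <- (pow1 (n - m)); apply pow_incr; split; [apply Cmod_ge_0 | assumption]. }
  assert (Rabs (s (S n)) * Cmod z ^ S n <= Rabs (s (S n)) * Cmod z ^ S m)
    by (apply Rmult_le_compat_l; [apply Rabs_pos | assumption]).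
  lra.
Qed.

(** The sum over the triangle i + j <= n, by antidiagonals on the left and by rows on the right. *)
Lemma psum_self_conv (z : C) (n : nat) :
  psum (fun k => RtoC (self_conv k)) (S n) z =
  sum_n (fun i => binom_half i * Cpow z i *
                  psum (fun k => RtoC (binom_half k)) (S (n - i)) z)%C n.
Proof.
set (x := fun i => (binom_half i * Cpow z i)%C).
set (P := fun m => psum (fun k => RtoC (binom_half k)) m z).
change (psum (fun k => RtoC (self_conv k)) (S n) z =
  sum_n (fun i => x i * P (S (n - i)))%C n).
(* The antidiagonal i + j = n, cut at i = m so that induction on m leaves n fixed. *)
assert (HC : forall n m, (m <= n)%nat ->
  sum_n (fun i => x i * x (n - i)%nat)%C m =
  (sum_f_R0 (fun i => (binom_half i * binom_half (n - i))%R) m * Cpow z n)%C).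
{ clear n; intros n m; induction m as [|m IH]; intros Hm.
  - rewrite sum_O; unfold x; simpl.
    rewrite !Nat.sub_0_r, RtoC_mult; cring.
  - rewrite sum_Sn, IH, tech5 by lia; unfold x.
    replace (Cpow z n) with (Cpow z (S m) * Cpow z (n - S m))%C
      by (rewrite <- Cpow_add_r; f_equal; lia).
    rewrite RtoC_plus, RtoC_mult; change plus with Cplus; cring. }
induction n as [|n IH].
- rewrite sum_O; unfold x, P; unfold self_conv; simpl; rewrite Rmult_1_l; cring.
- rewrite psum_S, IH, sum_Sn.
  rewrite (sum_n_ext_loc (fun i => x i * P (S (S n - i)))%C
    (fun i => plus (x i * P (S (n - i))) (x i * x (S n - i)%nat))%C).
  2:{ intros i Hi; unfold P; rewrite (psum_S _ (S n - i)).
      replace (S n - i)%nat with (S (n - i)) by lia.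
      unfold x; change plus with Cplus; cring. }
  rewrite sum_n_plus.
  assert (E := HC (S n) (S n) ltac:(lia)).
  rewrite sum_Sn in E; unfold self_conv; rewrite <- E.
  replace (S n - S n)%nat with 0%nat by lia.
  replace (P 1%nat) with (x 0%nat) by (unfold P, x; simpl; ring).
  change plus with Cplus; cring.
Qed.

Lemma Cmod_sum_n_le (u : nat -> C) (v : nat -> R) (n : nat) :
  (forall i, (i <= n)%nat -> Cmod (u i) <= v i) -> Cmod (sum_n u n) <= sum_f_R0 v n.
Proof.
intros H; induction n as [|n IH]; [rewrite sum_O; now apply H |].
rewrite sum_Sn, tech5; apply Rle_trans with (1 := Cmod_triangle _ _).
apply Rplus_le_compat; [apply IH; auto | now apply H].
Qed.

(** P^2 minus 1 + z consists of the products with i, j <= n + 1 < i + j. In row i the tail over j,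
    times z^i, is at most 2 |z|^(n+2), and the weights |b_i| again add up to at most 2. *)
Lemma binom_series_square (z : C) (n : nat) :
  Cmod z <= 1 ->
  let P := psum (fun k => RtoC (binom_half k)) (S (S n)) z in
  Cmod (P * P - (1 + z)) <= 4 * Cmod z ^ S (S n).
Proof.
intros Hz P.
assert (E : (1 + z)%C = psum (fun k => RtoC (self_conv k)) (S (S n)) z).
{ induction n as [|n IH].
  - unfold self_conv; simpl.
    replace (1 * (1 * (1 / 2 - 0) / 1) + 1 * (1 / 2 - 0) / 1 * 1) with 1 by field.
    rewrite Rmult_1_l; ring.
  - rewrite psum_S, self_conv_SS, <- IH; ring. }
rewrite E, psum_self_conv.
assert (EP : (P * P)%C = sum_n (fun i => binom_half i * Cpow z i * P)%C (S n)).
{ assert (H : forall m, psum (fun k => RtoC (binom_half k)) (S m) z =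
    sum_n (fun i => binom_half i * Cpow z i)%C m).
  { induction m as [|m IH]; [rewrite sum_O; simpl; cring |].
    rewrite psum_S, IH, sum_Sn; reflexivity. }
  unfold P at 1; rewrite H.
  symmetry; exact (sum_n_mult_r P (fun i => binom_half i * Cpow z i)%C (S n)). }
rewrite EP.
set (u := fun i => (binom_half i * Cpow z i * P)%C).
set (v := fun i => (binom_half i * Cpow z i *
   psum (fun k => RtoC (binom_half k)) (S (S n - i)) z)%C).
assert (D : forall m, (sum_n u m - sum_n v m)%C = sum_n (fun i => u i - v i)%C m).
{ induction m as [|m IH]; [now rewrite !sum_O |].
  rewrite !sum_Sn, <- IH; change plus with Cplus; cring. }
rewrite D.
set (A := sum_f_R0 (fun k => Rabs (binom_half k))).
apply Rle_trans with (sum_f_R0 (fun i => Rabs (binom_half i) * (2 * Cmod z ^ S (S n))) (S n)).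
- apply Cmod_sum_n_le; intros i Hi; unfold u, v.
  set (Q := psum _ (S (S n - i)) z).
  replace (binom_half i * Cpow z i * P - binom_half i * Cpow z i * Q)%C with
    (binom_half i * (Cpow z i * (P - Q)))%C by ring.
  rewrite !Cmod_mult, Cmod_R, Cmod_pow.
  apply Rmult_le_compat_l; [apply Rabs_pos |].
  assert (HQ := psum_diff_le binom_half z (S n - i) (S n) Hz ltac:(lia)).
  fold P in HQ; fold Q in HQ; fold A in HQ.
  replace (S (S n)) with (i + S (S n - i))%nat by lia; rewrite pow_add.
  replace (2 * (Cmod z ^ i * Cmod z ^ S (S n - i))) with
    (Cmod z ^ i * (Cmod z ^ S (S n - i) * 2)) by ring.
  apply Rmult_le_compat_l; [apply pow_le, Cmod_ge_0 |].
  apply Rle_trans with (1 := HQ); apply Rmult_le_compat_l; [apply pow_le, Cmod_ge_0 |].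
  assert (0 <= A (S n - i)%nat) by (apply cond_pos_sum; intros; apply Rabs_pos).
  generalize (sum_abs_binom_half_le (S n)); fold A; lra.
- rewrite <- scal_sum; fold A.
  assert (0 <= Cmod z ^ S (S n)) by apply pow_le, Cmod_ge_0.
  generalize (sum_abs_binom_half_le (S n)); fold A; nra.
Qed.

Lemma Csqrt_unique (z s : C) : (s * s)%C = z -> 0 < Re s -> Csqrt z = s.
Proof.
intros Hs Hre.
assert (H : ((Csqrt z - s) * (Csqrt z + s))%C = 0).
{ transitivity (Csqrt z * Csqrt z - s * s)%C; [ring |].
  rewrite Csqrt_sqr, Hs; ring. }
assert (N : (Csqrt z + s)%C <> 0).
{ intros E; apply (f_equal Re) in E.
  change (Re (Csqrt z) + Re s = 0) in E; generalize (Csqrt_Re_ge0 z); lra. }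
destruct (Ceq_dec (Csqrt z - s) 0) as [E | E]; [| now apply (Cmult_neq_0 _ _ E N) in H].
replace (Csqrt z) with (Csqrt z - s + s)%C by ring; rewrite E; ring.
Qed.

Lemma Cmod_limit_le (u : nat -> C) (l : C) (B : R) (N : nat) :
  (forall eps, 0 < eps -> exists N, forall n, (N <= n)%nat -> Cmod (u n - l) < eps) ->
  (forall n, (N <= n)%nat -> Cmod (u n) <= B) -> Cmod l <= B.
Proof.
intros Hl HB; apply le_epsilon; intros eps He; destruct (Hl eps He) as [M HM].
replace l with (- (u (N + M)%nat - l) + u (N + M)%nat)%C by ring.
apply Rle_trans with (1 := Cmod_triangle _ _); rewrite Cmod_opp.
generalize (HM (N + M)%nat ltac:(lia)) (HB (N + M)%nat ltac:(lia)); lra.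
Qed.

Lemma sqrt_1p_series (z : C) :
  in_disk z -> sums_to (fun k => RtoC (binom_half k)) z (sqrt_1p z).
Proof.
intros Hz.
assert (HA : forall n, Rabs (binom_half n) <= 2).
{ intros [|n]; [simpl; rewrite Rabs_R1; lra |].
  generalize (sum_abs_binom_half_le (S n)); rewrite tech5.
  assert (0 <= sum_f_R0 (fun k => Rabs (binom_half k)) n)
    by (apply cond_pos_sum; intros; apply Rabs_pos); lra. }
assert (T : tame (fun k => RtoC (binom_half k))).
{ intros rho Hr; exists 2; intros n; rewrite Cmod_R.
  assert (rho ^ n <= 1) by (rewrite <- (pow1 n); apply pow_incr; lra).
  assert (0 <= rho ^ n) by (apply pow_le; lra).
  generalize (HA n) (Rabs_pos (binom_half n)); nra. }
destruct (tame_sums _ z T Hz) as [s Hs]; unfold in_disk in Hz.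
unfold sqrt_1p; rewrite (Csqrt_unique _ s); [assumption | |].
- assert (Hl := proj1 (is_pseries_psum _ _ _) Hs).
  enough (E : Cmod (s * s - (1 + z)) = 0).
  { apply Cmod_eq_0 in E; replace (s * s)%C with (s * s - (1 + z) + (1 + z))%C by ring.
    rewrite E; ring. }
  apply Rle_antisym; [| apply Cmod_ge_0].
  apply le_epsilon; intros eps He; rewrite Rplus_0_l.
  assert (K0 : 0 < 2 * Cmod s + 1) by (generalize (Cmod_ge_0 s); lra).
  (* If |Q - s| < e then |Q^2 - s^2| <= e (1 + 2 |s|) <= eps/2; the other half of eps is for 4
     |z|^(n+2). *)
  set (e := Rmin 1 (eps / 2 / (2 * Cmod s + 1))).
  assert (e0 : 0 < e).
  { apply Rmin_pos; [lra |]; apply Rdiv_lt_0_compat; lra. }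
  assert (e1 : e <= 1) by apply Rmin_l.
  assert (e2 : e * (2 * Cmod s + 1) <= eps / 2).
  { replace (eps / 2) with (eps / 2 / (2 * Cmod s + 1) * (2 * Cmod s + 1)) by (field; lra).
    apply Rmult_le_compat_r; [lra | apply Rmin_r]. }
  destruct (Hl e e0) as [N HN].
  destruct (pow_lt_1_zero (Cmod z)
    ltac:(rewrite Rabs_pos_eq; [lra | apply Cmod_ge_0]) (eps / 8) ltac:(lra)) as [N' HN'].
  set (n := (N + N')%nat).
  specialize (HN (S (S n)) ltac:(lia)); specialize (HN' (S (S n)) ltac:(lia)).
  assert (HP := binom_series_square z n ltac:(lra)); cbv zeta in HP.
  set (Q := psum _ (S (S n)) z) in *.
  rewrite Rabs_pos_eq in HN' by apply pow_le, Cmod_ge_0.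
  replace (s * s - (1 + z))%C with ((Q * Q - (1 + z)) + - ((Q - s) * ((Q - s) + 2 * s)))%C
    by ring.
  apply Rle_trans with (1 := Cmod_triangle _ _); rewrite Cmod_opp, Cmod_mult.
  generalize (Cmod_triangle (Q - s) (2 * s)); rewrite Cmod_mult, Cmod_R.
  rewrite (Rabs_pos_eq 2) by lra; intros HT.
  assert (Cmod (Q - s) * Cmod (Q - s + 2 * s) <= e * (2 * Cmod s + 1))
    by (apply Rmult_le_compat; try apply Cmod_ge_0; lra).
  lra.
- assert (B : Cmod (s - 1) <= Cmod z).
  { apply (Cmod_limit_le (fun n => psum (fun k => RtoC (binom_half k)) n z - 1)%C _ _ 1).
    - intros eps He; destruct (proj1 (is_pseries_psum _ _ _) Hs eps He) as [N HN].
      exists N; intros n Hn.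
      replace (psum (fun k => RtoC (binom_half k)) n z - 1 - (s - 1))%C with
        (psum (fun k => RtoC (binom_half k)) n z - s)%C by ring.
      now apply HN.
    - intros [|n] Hn; [lia |].
      assert (HD := psum_diff_le binom_half z 0 n ltac:(lra) ltac:(lia)).
      replace (psum (fun k => RtoC (binom_half k)) 1 z) with (RtoC 1) in HD
        by (simpl; ring).
      replace (sum_f_R0 (fun k => Rabs (binom_half k)) 0) with 1 in HD
        by (symmetry; apply Rabs_R1).
      rewrite pow_1 in HD; apply Rle_trans with (1 := HD).
      generalize (sum_abs_binom_half_le n) (Cmod_ge_0 z); nra. }
  generalize (re_le_Cmod (s - 1)); change (Re (s - 1)) with (Re s + - (1)); intros HRe.
  destruct (Rabs_def2 (Re s + - (1)) 1); lra.
Qed.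

(* The coefficients of the substitution of z^2 for z. *)
Definition even_coefs (a : nat -> C) (n : nat) : C :=
  if Nat.even n then a (Nat.div2 n) else 0.

Lemma psum_even_coefs (a : nat -> C) (z : C) (n : nat) :
  psum (even_coefs a) n z = psum a (Nat.div2 (S n)) (z * z)%C.
Proof.
(* Two consecutive lengths are proved together because the recursion removes two terms at a time; n
   terms in z contain n/2 terms in z^2, rounded up. *)
enough (H : psum (even_coefs a) n z = psum a (Nat.div2 (S n)) (z * z)%C /\
  psum (even_coefs a) (S n) z = psum a (Nat.div2 (S (S n))) (z * z)%C) by apply H.
revert a; induction n as [|n IH]; intros a.
- split; [reflexivity |]; unfold even_coefs; simpl; ring.
- split; [apply IH |].
  change (psum (even_coefs a) (S (S n)) z) with
    (a 0%nat + z * (0 + z * psum (even_coefs (fun k => a (S k))) n z))%C.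
  rewrite (proj1 (IH _)).
  change (psum a (Nat.div2 (S (S (S n)))) (z * z)%C) with
    (a 0%nat + (z * z) * psum (fun k => a (S k)) (Nat.div2 (S n)) (z * z))%C.
  ring.
Qed.

Lemma even_coefs_sums (a : nat -> C) (z l : C) :
  sums_to a (z * z)%C l -> sums_to (even_coefs a) z l.
Proof.
rewrite !is_pseries_psum; intros H eps He; destruct (H eps He) as [N HN].
exists (2 * N)%nat; intros n Hn; rewrite psum_even_coefs; apply HN.
rewrite Nat.div2_div; apply Nat.div_le_lower_bound; lia.
Qed.

(** * The class R *)

Definition hyp_coef (a b c : R) (n : nat) : R :=
  poch a n * poch b n / (poch c n * INR (fact n)).

Lemma hyp_coef_0 (a b c : R) : hyp_coef a b c 0 = 1.
Proof. unfold hyp_coef; simpl; field. Qed.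

Lemma poch_pos (x : R) (n : nat) : 0 < x -> 0 < poch x n.
Proof.
intros Hx; induction n as [|n IH]; simpl; [lra |].
apply Rmult_lt_0_compat; [assumption |]; generalize (pos_INR n); lra.
Qed.

Lemma poch_le (x y : R) (n : nat) : 0 < x -> x <= y -> poch x n <= poch y n.
Proof.
intros Hx Hxy; induction n as [|n IH]; simpl; [lra |].
generalize (poch_pos x n Hx) (pos_INR n); intros.
apply Rmult_le_compat; lra.
Qed.

Lemma fact_le_poch (b : R) (n : nat) :
  0 < b -> Rmin 1 b * INR (fact n) <= poch b (S n).
Proof.
intros Hb; induction n as [|n IH].
- simpl; generalize (Rmin_r 1 b); lra.
- change (poch b (S (S n))) with (poch b (S n) * (b + INR (S n))).
  rewrite fact_simpl, mult_INR.
  generalize (pos_INR (S n)) (poch_pos b (S n) Hb); nra.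
Qed.

Lemma hyp_coef_pos (a b c : R) (n : nat) : 0 < a -> 0 < b -> 0 < c -> 0 < hyp_coef a b c n.
Proof.
intros Ha Hb Hc; unfold hyp_coef.
generalize (poch_pos a n Ha) (poch_pos b n Hb) (poch_pos c n Hc) (INR_fact_lt_0 n); intros.
apply Rdiv_lt_0_compat; now apply Rmult_lt_0_compat.
Qed.

(** (c)_n <= (a)_n, and n! / (b)_n grows at most linearly. Dividing coefficients by [hyp_coef]
    therefore keeps them [tame], which makes the Hohlov operator invertible on series. *)
Lemma hyp_coef_inv_le (a b c : R) (n : nat) :
  0 < c -> c <= a -> 0 < b -> / hyp_coef a b c n <= / Rmin 1 b * INR (S n).
Proof.
intros Hc Ha Hb.
assert (Pa := poch_pos a n ltac:(lra)); assert (Pb := poch_pos b n Hb).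
assert (Pc := poch_pos c n Hc); assert (Pf := INR_fact_lt_0 n).
assert (Hm : 0 < Rmin 1 b) by (apply Rmin_pos; lra).
assert (HF : Rmin 1 b * INR (fact n) <= INR (S n) * poch b n).
{ destruct n as [|n].
  - simpl; generalize (Rmin_l 1 b); lra.
  - rewrite fact_simpl, mult_INR.
    assert (H1 := fact_le_poch b n Hb).
    assert (H2 : INR (S n) <= INR (S (S n))) by (apply le_INR; lia).
    generalize (pos_INR (S n)); nra. }
replace (/ hyp_coef a b c n) with (poch c n * INR (fact n) / (poch a n * poch b n))
  by (unfold hyp_coef; field; repeat split; lra).
apply Rmult_le_reg_r with (Rmin 1 b * (poch a n * poch b n)).
{ repeat apply Rmult_lt_0_compat; assumption. }
replace (poch c n * INR (fact n) / (poch a n * poch b n) * (Rmin 1 b * (poch a n * poch b n)))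
  with (poch c n * (Rmin 1 b * INR (fact n))) by (field; lra).
replace (/ Rmin 1 b * INR (S n) * (Rmin 1 b * (poch a n * poch b n)))
  with (poch a n * (INR (S n) * poch b n)) by (field; lra).
apply Rmult_le_compat; [lra | nra | now apply poch_le | assumption].
Qed.

(** Inverts the Hohlov operator on z sqrt(1 + w(z)), so that a Schwarz function w produces a member
    of the class with explicit coefficients. *)
Lemma classR_of_schwarz (a b c : R) (q : nat -> C) (w : C -> C) :
  0 < c -> c <= a -> c <= b ->
  analytic_in_disk w -> w 0 = 0 -> (forall z, in_disk z -> in_disk (w z)) ->
  q 0%nat = 1 -> disk_series q (fun z => sqrt_1p (w z)) ->
  exists (f : C -> C) (t : nat -> C),
    classR a b c f /\ disk_series t f /\
    forall n, t (S n) = (RtoC (/ hyp_coef a b c n) * q n)%C.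
Proof.
intros Hc Ha Hb Hw Hw0 Hwd Hq0 Hq.
set (v := fun n => (RtoC (/ hyp_coef a b c n) * q n)%C).
assert (Hpos : forall n, 0 < hyp_coef a b c n) by (intros n; apply hyp_coef_pos; lra).
assert (Tv : tame v).
{ apply (tame_le (fun n => INR (S n) * q n)%C _ (/ Rmin 1 b)).
  - apply Rlt_le, Rinv_0_lt_compat, Rmin_pos; lra.
  - intros n; unfold v; rewrite !Cmod_mult, !Cmod_R, (Rabs_pos_eq (INR _)) by apply pos_INR.
    rewrite Rabs_pos_eq by apply Rlt_le, Rinv_0_lt_compat, Hpos.
    rewrite <- Rmult_assoc; apply Rmult_le_compat_r; [apply Cmod_ge_0 |].
    apply hyp_coef_inv_le; lra.
  - apply tame_mult_INR, (tame_of_pseries q (fun z => sqrt_1p (w z))); auto. }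
(* The sum is picked by choice; outside the disk its value is arbitrary. *)
set (V := fun z => epsilon (inhabits (RtoC 0)) (fun l : C => sums_to v z l)).
set (t := @PS_incr_1 C_AbsRing C_NormedModule v).
assert (Ht : disk_series t (fun z => z * V z)%C).
{ intros z Hz; apply (is_pseries_incr_1 v z (V z)).
  apply (epsilon_spec (inhabits (RtoC 0)) (fun l : C => sums_to v z l)).
  now apply tame_sums. }
exists (fun z => z * V z)%C, t; split; [| now split].
split.
- split; [now apply (disk_series_analytic t) |].
  exists t; split; [reflexivity |]; split; [| assumption].
  change (RtoC (/ hyp_coef a b c 0) * q 0%nat = 1)%C.
  rewrite hyp_coef_0, Hq0, Rinv_1; ring.
- exists (fun z => z * sqrt_1p (w z))%C, (fun z => sqrt_1p (w z)); split; [| split].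
  + exists t; split; [assumption |].
    intros z Hz.
    apply (is_pseries_ext (@PS_incr_1 C_AbsRing C_NormedModule q)).
    * intros [|n]; unfold hadamard_coef, t; simpl; [change zero with (RtoC 0); ring |].
      unfold v, hyp2F1_coef; fold (hyp_coef a b c n).
      rewrite Cmult_assoc, <- RtoC_mult, Rinv_r by (apply Rgt_not_eq, Hpos); ring.
    * apply (is_pseries_incr_1 q z (sqrt_1p (w z))), Hq, Hz.
  + split; [now apply (disk_series_analytic q) |].
    intros z Hz Hz0; field; assumption.
  + exists w; split; [assumption |]; split; [assumption |].
    intros z Hz; split; [now apply Hwd | reflexivity].
Qed.

(* The nu for which a_3 - mu a_2^2 is a multiple of w_2 - nu w_1^2. *)
Definition fs_param (a b c : R) (mu : C) : C :=
  ((RtoC (a * b * (c + 1)) + mu * RtoC (c * (a + 1) * (b + 1))) *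
   RtoC (/ (4 * a * b * (c + 1))))%C.

(** With K = (c)_2 / ((a)_2 (b)_2), the factor of q2 is 2K and that of q1^2 is (c / (a b))^2. The
    q1^2 inside w2 is compensated by the summand 1/4 of [fs_param]. *)
Lemma fekete_szego_schwarz (a b c : R) (mu q1 q2 : C) :
  0 < a -> 0 < b -> 0 < c ->
  (RtoC (/ hyp_coef a b c 2) * q2 -
     mu * ((RtoC (/ hyp_coef a b c 1) * q1) * (RtoC (/ hyp_coef a b c 1) * q1)))%C =
  (RtoC (poch c 2 / (poch a 2 * poch b 2)) *
   (2 * q2 + q1 * q1 - fs_param a b c mu * ((2 * q1) * (2 * q1))))%C.
Proof.
intros Ha Hb Hc; unfold fs_param, hyp_coef; simpl.
destruct mu as [m1 m2], q1 as [x1 x2], q2 as [y1 y2].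
unfold Cminus, Cplus, Cmult, Copp, RtoC; simpl; f_equal; field; repeat split; lra.
Qed.

Lemma Cmod_fs_param (a b c : R) (mu : C) :
  0 < a -> 0 < b -> 0 < c ->
  Cmod (fs_param a b c mu) =
  Cmod (RtoC (a * b * (c + 1)) + mu * RtoC (c * (a + 1) * (b + 1))) /
    (4 * a * b * (c + 1)).
Proof.
intros Ha Hb Hc; unfold fs_param; rewrite Cmod_mult, Cmod_R, Rabs_pos_eq; [reflexivity |].
apply Rlt_le, Rinv_0_lt_compat; repeat apply Rmult_lt_0_compat; lra.
Qed.

(** Uniqueness of coefficients identifies [t] with the series hidden in [classA] and in [hohlov].
    Squaring the principal root then turns subordination into |p^2 - 1| < 1. *)
Lemma classR_quotient_series (a b c : R) (f : C -> C) (t : nat -> C) :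
  classR a b c f -> disk_series t f ->
  t 1%nat = 1 /\ exists p : C -> C,
    (forall z : C, z <> 0 -> in_disk z ->
       sums_to (fun n => RtoC (hyp_coef a b c n) * t (S n))%C z (p z)) /\
    (forall z : C, z <> 0 -> in_disk z -> Cmod (p z * p z - 1) < 1).
Proof.
intros [[_ [t' [_ [Ht'1 Ht']]]] [g [p [[s [Hs Hg]] [[_ Hp] [w [_ [_ Hw]]]]]]]] Ht.
split; [now rewrite (disk_series_unique t t' f Ht Ht') |].
exists p; split; intros z Hz0 Hz.
- assert (E := is_pseries_decr_1 _ z (/ z)%C _ (Cinv_l z Hz0) (Hg z Hz)).
  apply (is_pseries_ext _ (fun n => RtoC (hyp_coef a b c n) * t (S n))%C) in E.
  + rewrite (Hp z Hz Hz0).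
    replace (g z / z)%C with (@scal C_AbsRing C_NormedModule (/ z)%C
      (plus (g z) (opp (hadamard_coef
        (@PS_incr_1 C_AbsRing C_NormedModule (hyp2F1_coef a b c)) s 0)))); [exact E |].
    unfold hadamard_coef; simpl PS_incr_1.
    change (/ z * (g z + - (0 * s 0%nat)) = g z / z)%C; field; assumption.
  + intros n; unfold PS_decr_1, hadamard_coef; simpl.
    now rewrite (disk_series_unique t s f Ht Hs).
- destruct (Hw z Hz) as [Hwd ->]; unfold sqrt_1p; rewrite Csqrt_sqr.
  replace (1 + w z - 1)%C with (w z) by ring; exact Hwd.
Qed.

Lemma analytic_id : analytic_in_disk (fun z => z).
Proof.
intros z0 _; apply (ex_derive_of_quadratic_remainder _ z0 1 1 0 Rlt_0_1).
intros z _; replace (z - z0 - (z - z0) * 1)%C with (RtoC 0) by ring; rewrite Cmod_0; lra.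
Qed.

Lemma analytic_sqr : analytic_in_disk (fun z => z * z)%C.
Proof.
intros z0 _; apply (ex_derive_of_quadratic_remainder _ z0 (2 * z0)%C 1 1 Rlt_0_1).
intros z _; replace (z * z - z0 * z0 - (z - z0) * (2 * z0))%C with ((z - z0) * (z - z0))%C
  by ring; rewrite Cmod_mult; lra.
Qed.

Theorem theorem2p1 (a b c : R) (hc : 0 < c) (hac : c <= a) (hbc : c <= b) (mu : C) :
  let bound :=
    poch c 2 / (poch a 2 * poch b 2) *
    Rmax 1
      (Cmod (Cplus (RtoC (a * b * (c + 1)))
                   (Cmult mu (RtoC (c * (a + 1) * (b + 1)))))
       / (4 * a * b * (c + 1))) in
  let fekete_szego (t : nat -> C) : R :=
    Cmod (Cminus (t 3%nat) (Cmult mu (Cmult (t 2%nat) (t 2%nat)))) in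
  (forall (f : C -> C) (t : nat -> C),
      classR a b c f -> disk_series t f -> fekete_szego t <= bound) /\
  (exists (f : C -> C) (t : nat -> C),
      classR a b c f /\ disk_series t f /\ fekete_szego t = bound).
Proof.
intros bound fekete_szego; unfold bound.
assert (Ha : 0 < a) by lra; assert (Hb : 0 < b) by lra.
rewrite <- Cmod_fs_param by assumption.
set (K := poch c 2 / (poch a 2 * poch b 2)); set (nu := fs_param a b c mu).
assert (HK : 0 < K).
{ generalize (poch_pos a 2 Ha) (poch_pos b 2 Hb) (poch_pos c 2 hc); intros.
  apply Rdiv_lt_0_compat; [assumption | now apply Rmult_lt_0_compat]. }
assert (Hfs : forall q1 q2 t, t 2%nat = (RtoC (/ hyp_coef a b c 1) * q1)%C ->
  t 3%nat = (RtoC (/ hyp_coef a b c 2) * q2)%C ->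
  fekete_szego t = K * Cmod (2 * q2 + q1 * q1 - nu * ((2 * q1) * (2 * q1)))).
{ intros q1 q2 t E1 E2; unfold fekete_szego.
  rewrite E1, E2, fekete_szego_schwarz by assumption.
  rewrite Cmod_mult, Cmod_R, Rabs_pos_eq by (fold K; lra); reflexivity. }
split.
- intros f t Hf Ht.
  destruct (classR_quotient_series a b c f t Hf Ht) as [Ht1 [p [Hp Hw]]].
  set (q := fun n => (RtoC (hyp_coef a b c n) * t (S n))%C) in *.
  assert (Hq : forall n, t (S n) = (RtoC (/ hyp_coef a b c n) * q n)%C).
  { intros n; unfold q; rewrite Cmult_assoc, <- RtoC_mult, Rinv_l; [ring |].
    apply Rgt_not_eq, hyp_coef_pos; assumption. }
  rewrite (Hfs (q 1%nat) (q 2%nat) t (Hq 1%nat) (Hq 2%nat)).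
  apply Rmult_le_compat_l; [lra |].
  apply coef_bound_of_parseval; intros b'.
  apply (square_disk_parseval q p b' Hp); [| assumption].
  unfold q; rewrite hyp_coef_0, Ht1; ring.
(* If |nu| <= 1, w = z^2 has w_1 = 0, w_2 = 1 and attains 1; otherwise w = z has w_1 = 1, w_2 = 0
   and attains |nu|. *)
- destruct (Rle_lt_dec (Cmod nu) 1) as [L | L].
  + destruct (classR_of_schwarz a b c (even_coefs (fun k => RtoC (binom_half k)))
      (fun z => z * z)%C hc hac hbc analytic_sqr) as [f [t [Hf [Ht Et]]]].
    * ring.
    * intros z Hz; unfold in_disk in *; rewrite Cmod_mult.
      generalize (Cmod_ge_0 z); nra.
    * reflexivity.
    * intros z Hz; apply even_coefs_sums, sqrt_1p_series.
      unfold in_disk in *; rewrite Cmod_mult; generalize (Cmod_ge_0 z); nra.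
    * exists f, t; split; [assumption |]; split; [assumption |].
      rewrite (Hfs _ _ t (Et 1%nat) (Et 2%nat)); unfold even_coefs; simpl.
      rewrite Rmax_left by assumption; f_equal.
      replace (2 * _ + _ - _)%C with (RtoC 1); [apply Cmod_1 |].
      replace (1 * (1 / 2 - 0) / 1) with (/ 2) by field.
      rewrite RtoC_inv by lra; field.
  + destruct (classR_of_schwarz a b c (fun k => RtoC (binom_half k))
      (fun z => z) hc hac hbc analytic_id) as [f [t [Hf [Ht Et]]]].
    * reflexivity.
    * easy.
    * reflexivity.
    * intros z Hz; now apply sqrt_1p_series.
    * exists f, t; split; [assumption |]; split; [assumption |].
      rewrite (Hfs _ _ t (Et 1%nat) (Et 2%nat)); simpl.
      rewrite Rmax_right by lra; f_equal; rewrite <- Cmod_opp; f_equal.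
      destruct nu as [n1 n2]; unfold Cminus, Cplus, Cmult, Copp, RtoC; simpl.
      f_equal; field.
Qed.
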